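(* Let $\Gamma$ be a countable discrete group. If $\Gamma \curvearrowright^a X$ is a topological $\Gamma$-system and $\mu$ is an invariant (Borel probability) measure for $\Gamma \curvearrowright^a X$, then $$h_{\mathrm{nv}}(\Gamma \curvearrowright^a (X,\mu)) \leq h^{\mathrm{tp}}_{\mathrm{nv}}(\Gamma \curvearrowright^a X).$$
   Context: A topological $\Gamma$-system $\Gamma \curvearrowright^a X$ consists of a compact metrizable space $X$ and a homomorphism $a:\Gamma\to \mathrm{Homeo}(X)$; write $\gamma^a$ for $a(\gamma)$. Naive topological entropy. For an open cover $\mathscr{U}$ of $X$, $N(\mathscr{U})$ is the minimal cardinality of a subcover. The join of finitely many open covers (or partitions) consists of all intersections of one element from each. Put $\gamma^a\mathscr{U}=\{\gamma^a U: U\in\mathscr{U}\}$ and, for finite $F\subseteq\Gamma$, $\mathscr{U}^F=\bigvee_{\gamma\in F}\gamma^a\mathscr{U}$. Define $h^{\mathrm{tp}}_{\mathrm{nv}}(\mathscr{U})=\inf_F \frac{1}{|F|}\log N(\mathscr{U}^F)$, the infimum over all nonempty finite $F\subseteq\Gamma$, and $h^{\mathrm{tp}}_{\mathrm{nv}}(\Gamma\curvearrowright^a X)=\sup\{h^{\mathrm{tp}}_{\mathrm{nv}}(\mathscr{U}) : \mathscr{U}\text{ a finite open cover of }X\}$. Naive measure entropy. For a finite measurable partition $\alpha=(A_1,\dots,A_n)$ of $(X,\mu)$, $H_\mu(\alpha)=-\sum_{i=1}^n\mu(A_i)\log\mu(A_i)$. Put $\gamma^a\alpha=\{\gamma^aA:A\in\alpha\}$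 and $\alpha^F=\bigvee_{\gamma\in F}\gamma^a\alpha$ for finite $F\subseteq\Gamma$. Define $h_\mu(\alpha)=\inf_F\frac1{|F|}H_\mu(\alpha^F)$, the infimum over all nonempty finite $F\subseteq\Gamma$, and $h_{\mathrm{nv}}(\Gamma\curvearrowright^a(X,\mu))=\sup\{h_\mu(\alpha):\alpha\text{ a finite measurable partition of }X\}$. Entropies take values in $[0,\infty]$. *)

(* Defs.v *)
From HB Require Import structures.
From mathcomp Require Import all_boot all_order all_algebra.
From mathcomp Require Import finmap.
From mathcomp Require Import all_classical all_reals all_analysis.

Set Implicit Arguments.
Unset Strict Implicit.
Unset Printing Implicit Defensive.

Import Order.TTheory GRing.Theory Num.Theory.
Import numFieldNormedType.Exports.

Local Open Scope classical_set_scope.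
Local Open Scope ring_scope.

Definition metrizable (R : realType) (X : topologicalType) : Prop :=
  exists d : X -> X -> R,
    [/\ forall x y, d x y = 0 <-> x = y,
        forall x y, d x y = d y x,
        forall x y z, d x z <= d x y + d y z &
        forall U : set X, open U <->
          forall x, U x -> exists2 e, 0 < e & [set y | d x y < e] `<=` U].

Definition homeomorphism (X Y : topologicalType) (f : X -> Y) : Prop :=
  continuous f /\
  exists g : Y -> X, [/\ continuous g, cancel f g & cancel g f].

(* A homomorphism from Gamma to Homeo(X), the group law of Homeo(X) being
   composition; a 1 = id follows since a 1 is injective. *)
Definition top_action (Gamma : groupType) (X : topologicalType)
    (a : Gamma -> X -> X) : Prop :=
  (forall g, homeomorphism (a g)) /\
  (forall g h, a (g * h)%g = a g \o a h).

(* The Borel sets of X; the pointedness required by measurableType is no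
   restriction for a space carrying a probability measure. *)
Notation borel X := (g_sigma_algebraType (@open X)).

Definition invariant_measure (R : realType) (Gamma : groupType)
    (X : ptopologicalType)
    (a : Gamma -> X -> X) (mu : probability (borel X) R) : Prop :=
  forall g (A : set (borel X)), measurable A -> mu (a g @^-1` A) = mu A.

(* Covers and partitions are sets of subsets of X. Two distinct choices of
   cells can only give the same element of a join of partitions if that element
   is empty, so nothing is lost by not indexing the cells. *)

Definition translate (Gamma X : Type) (a : Gamma -> X -> X) (g : Gamma)
    (C : set (set X)) : set (set X) := [set a g @` A | A in C].

Definition joint_refinement (I : choiceType) (X : Type) (F : {fset I})
    (C : I -> set (set X)) : set (set X) :=
  [set \bigcap_(i in [set` F]) A i
     | A in [set A : I -> set X | forall i, i \in F -> C i (A i)]].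

Definition join_translates (Gamma : groupType) (X : Type)
    (a : Gamma -> X -> X) (C : set (set X)) (F : {fset Gamma}) :
    set (set X) :=
  joint_refinement F (fun g => translate a g C).

Definition finite_open_cover (X : topologicalType) (U : set (set X)) : Prop :=
  [/\ finite_set U, forall A, U A -> open A & cover U id = setT].

Definition finite_measurable_partition (X : ptopologicalType)
    (P : set (set (borel X))) : Prop :=
  [/\ finite_set P, forall A, P A -> measurable A,
      cover P id = setT & trivIset P id].

Definition has_subcover (X : Type) (U : set (set X)) (n : nat) : Prop :=
  exists V : {fset set X},
    [/\ [set` V] `<=` U, cover [set` V] id = setT & #|` V| = n].

(* Only meaningful when U has a finite subcover (default value 0 otherwise). *)
Definition min_subcover (X : Type) (U : set (set X)) : nat :=
  [get n | has_subcover U n /\ forall m, has_subcover U m -> (n <= m)%N].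

Section topological_entropy.
Variables (R : realType) (Gamma : groupType) (X : topologicalType).
Variable a : Gamma -> X -> X.

Definition naive_top_entropy_cover (U : set (set X)) : \bar R :=
  ereal_inf
    [set ((#|` F|%:R)^-1 * ln (min_subcover (join_translates a U F))%:R)%:E
       | F in [set F : {fset Gamma} | F != fset0]].

Definition naive_top_entropy : \bar R :=
  ereal_sup [set naive_top_entropy_cover U
               | U in [set U | finite_open_cover U]].

End topological_entropy.

Section measure_entropy.
Variables (R : realType) (Gamma : groupType) (X : ptopologicalType).
Variables (a : Gamma -> X -> X) (mu : probability (borel X) R).

(* As ln 0 = 0, null cells contribute 0. *)
Definition shannon_entropy (P : set (set (borel X))) : R :=
  - \sum_(A \in P) fine (mu A) * ln (fine (mu A)).

Definition naive_measure_entropy_partition (P : set (set (borel X))) :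
    \bar R :=
  ereal_inf
    [set ((#|` F|%:R)^-1 * shannon_entropy (join_translates a P F))%:E
       | F in [set F : {fset Gamma} | F != fset0]].

Definition naive_measure_entropy : \bar R :=
  ereal_sup [set naive_measure_entropy_partition P
               | P in [set P | finite_measurable_partition P]].

End measure_entropy.

(* Main.v *)
Require Import Defs.
From mathcomp Require Import all_boot all_order all_algebra finmap.
From mathcomp Require Import all_classical all_reals all_analysis.
From mathcomp Require Import measurable_realfun ring lra.

(* Given a partition P, choose closed subsets B_i of its cells P_i whose union
   misses only a set "bad" of small measure, and let U_i be the complement of the
   union of the B_j with j != i. A point of U_i outside bad lies in P_i. Hence,
   once a member of a minimal subcover of U^F containing x is known, the P-name
   of x along F is known except at the times when the orbit is in bad, and by
   invariance this happens with small probability at each time. Coding the P-name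
   accordingly gives H(P^F) <= log N(U^F) + |F| e for every finite F, with e
   independent of F, so no amenability is needed to compare the two infima. *)

Set Implicit Arguments.
Unset Strict Implicit.
Unset Printing Implicit Defensive.

Import Order.TTheory GRing.Theory Num.Theory.
Import numFieldNormedType.Exports.

Local Open Scope classical_set_scope.
Local Open Scope ring_scope.

(** * Inequalities for probability measures *)

Section finite_measure.
Context {disp : measure_display} {T : measurableType disp} {R : realType}.
Variable mu : probability T R.

Lemma nonincreasing_measure_lt (D : (set T)^nat) (e : \bar R) :
  (forall n, measurable (D n)) -> nonincreasing_seq D ->
  (mu (\bigcap_n D n) < e)%E -> exists n, (mu (D n) < e)%E.
Proof.
move=> mD ndD De.
have cD : mu \o D @ \oo --> mu (\bigcap_n D n).
  apply: nonincreasing_cvg_mu => //.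
    by rewrite ltey_eq fin_num_measure.
  by apply: bigcap_measurable => //; exact: nat_nonempty.
have [n _ /(_ n (leqnn n))] := cD _ (open_ereal_lt' De).
by exists n.
Qed.

(** Integrate the pointwise inequality; the constant [D] keeps its value because [mu] has total mass
    1. Later this turns a pointwise bound on code lengths into a bound on their mean. *)
Lemma le_sum_measure_indic (I J : finType) (c : I -> R) (S : I -> set T)
    (D : R) (d : J -> R) (Q : J -> set T) :
  (forall i, 0 <= c i) -> 0 <= D -> (forall j, 0 <= d j) ->
  (forall i, measurable (S i)) -> (forall j, measurable (Q j)) ->
  (forall x, \sum_i c i * \1_(S i) x <= D + \sum_j d j * \1_(Q j) x) ->
  \sum_i c i * fine (mu (S i)) <= D + \sum_j d j * fine (mu (Q j)).
Proof.
move=> c0 D0 d0 mS mQ le_cd.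
have int_indic (K : finType) (b : K -> R) (Z : K -> set T) :
    (forall k, 0 <= b k) -> (forall k, measurable (Z k)) ->
    (\int[mu]_x (\sum_k b k * \1_(Z k) x)%:E
      = (\sum_k b k * fine (mu (Z k)))%:E)%E.
  move=> b0 mZ.
  under eq_integral do rewrite -sumEFin.
  rewrite ge0_integral_sum//; last first.
    by move=> k x _; rewrite lee_fin mulr_ge0.
    by move=> k; apply/measurable_EFinP; apply: measurable_funM.
  rewrite -sumEFin; apply: eq_bigr => k _.
  under eq_integral do rewrite EFinM.
  rewrite ge0_integralZl//; last 2 first.
    by apply/measurable_EFinP.
    by rewrite lee_fin b0.
  by rewrite integral_indic// setIT EFinM fineK// fin_num_measure.
have mI (K : finType) (b : K -> R) (Z : K -> set T) :
    (forall k, measurable (Z k)) ->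
    measurable_fun [set: T] (fun x => (\sum_k b k * \1_(Z k) x)%:E).
  move=> mZ; apply/measurable_EFinP; apply: measurable_sum => k.
  exact: measurable_funM.
rewrite -lee_fin -int_indic// EFinD -int_indic//.
rewrite -[D%:E]mule1 -(probability_setT mu) -integral_cst//.
rewrite -ge0_integralD//; last 2 first.
- by move=> x _; rewrite lee_fin sumr_ge0// => j _; rewrite mulr_ge0.
- exact: mI.
apply: ge0_le_integral => //.
- by move=> x _; rewrite lee_fin sumr_ge0// => j _; rewrite mulr_ge0.
- exact: mI.
- by apply: emeasurable_funD => //; exact: mI.
- by move=> x _; rewrite -EFinD lee_fin.
Qed.

Lemma fine_measure_le_sum (J : finType) (A : set T) (Q : J -> set T) :
  measurable A -> (forall j, measurable (Q j)) ->
  (forall x, A x -> exists j, Q j x) ->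
  fine (mu A) <= \sum_j fine (mu (Q j)).
Proof.
move=> mA mQ AQ.
have := @le_sum_measure_indic unit J (fun=> 1) (fun=> A) 0 (fun=> 1) Q.
rewrite big_const card_unit/= addr0 mul1r add0r.
under [X in _ -> _ -> _ -> _ -> _ -> _ -> _ <= X]eq_bigr do rewrite mul1r.
apply=> // x; rewrite big_const card_unit/= addr0 mul1r add0r.
have [Ax|nAx] := pselect (A x); last first.
  by rewrite indicE memNset// sumr_ge0// => j _; rewrite mulr_ge0.
have [j Qx] := AQ x Ax.
rewrite (bigD1 j)//= mul1r !indicE !mem_set//= lerDl.
by rewrite sumr_ge0// => w' _; rewrite mulr_ge0.
Qed.

End finite_measure.

(** * Regularity of Borel probability measures on metrizable spaces *)

Section regularity.
Variables (R : realType) (X : ptopologicalType) (mu : probability (borel X) R).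

Lemma open_measurable_borel (U : set X) :
  open U -> measurable (U : set (borel X)).
Proof. exact: sub_sigma_algebra. Qed.

Lemma continuous_measurable_borel (h : X -> X) (A : set (borel X)) :
  continuous h -> measurable A -> measurable (h @^-1` A : set (borel X)).
Proof.
move=> /continuousP ch mA; rewrite -[_ @^-1` _]setTI.
have mh : measurable_fun [set: borel X] (h : borel X -> borel X).
  apply: (@measurability _ _ (borel X) (borel X) _ _ (@open X)) => //.
  move=> _ [U oU <-].
  by rewrite setTI; apply: open_measurable_borel; exact: ch.
exact: mh.
Qed.

Lemma closed_measurable_borel (C : set X) :
  closed C -> measurable (C : set (borel X)).
Proof.
move=> cC; rewrite -[C]setCK; apply: measurableC.
by apply: open_measurable_borel; exact: closed_openC.
Qed.

(** Only the closed set inside [A] is wanted in the end; the open set around [A] makes the property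
    symmetric under complements. *)
Let regular (A : set X) := forall e : R, 0 < e -> exists C O : set X,
  [/\ closed C, open O, C `<=` A, A `<=` O &
      (mu (O `\` C : set (borel X)) <= e%:E)%E].

Lemma metrizable_open_regular (U : set X) :
  metrizable R X -> open U -> regular U.
Proof.
move=> [d [d0 dC dtri dopen]] oU e e0.
(* The points at distance at least [1/(n+1)] from the complement of [U] form closed sets that
   increase to [U]. *)
pose C n := [set x : X | [set y | d x y < n.+1%:R^-1] `<=` U].
have cC n : closed (C n).
  rewrite -[C n]setCK; apply: open_closedC; apply/dopen => x /existsNP[y].
  (* A point [y] outside [U] within [1/(n+1)] of [x] stays that close to every [z] in the ball of
     this radius around [x]. *)
  move=> /not_implyP[/= dxy Uy]; exists (n.+1%:R^-1 - d x y).
    by rewrite subr_gt0.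
  move=> z /= dxz; apply/existsNP; exists y; apply/not_implyP; split => //=.
  by rewrite (le_lt_trans (dtri z x y))// (dC z x) -ltrBrDr.
have CU n : C n `<=` U.
  by move=> x; apply => /=; rewrite (iffRL (d0 _ _) erefl) invr_gt0.
have mC n : measurable (U `\` C n : set (borel X)).
  by apply: measurableD;
    [exact: open_measurable_borel | exact: closed_measurable_borel].
have [||n ltn] := @nonincreasing_measure_lt _ _ _ mu
    (fun n => U `\` C n) e%:E mC.
- apply/nonincreasing_seqP => n; apply/subsetPset => x [Ux nC]; split => //.
  apply: contra_not nC => Cx y /= dxy; apply: Cx => /=.
  by rewrite (lt_le_trans dxy)// lef_pV2 ?posrE// ler_nat.
- suff -> : \bigcap_n (U `\` C n) = set0 by rewrite measure0 lte_fin.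
  rewrite -subset0 => x Hx; have [Ux _] := Hx 0 I.
  have [r r0 rU] := (dopen U).1 oU x Ux.
  have [n rn] : exists n, n.+1%:R^-1 < r.
    exists (Num.truncn r^-1).
    rewrite -[ltRHS]invrK ltf_pV2 ?posrE ?invr_gt0//.
    exact: truncnS_gt.
  have [_ /= nC] := Hx n I; apply: nC => y /= dxy; apply: rU => /=.
  exact: lt_trans rn.
exists (C n), U; split => //; exact: ltW.
Qed.

(** The regular sets form a sigma-algebra containing the open sets. *)
Lemma borel_regular (A : set (borel X)) :
  metrizable R X -> measurable A -> regular A.
Proof.
move=> metX; apply: smallest_sub => [|U]; last exact: metrizable_open_regular.
split.
- by apply: metrizable_open_regular => //; exact: open0.
- move=> B rB e e0; have [C [V [cC oO CB BO le_e]]] := rB e e0.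
  exists (~` V), (~` C); split.
  + exact: open_closedC.
  + exact: closed_openC.
  + by rewrite setTD; exact: subsetC.
  + by rewrite setTD; exact: subsetC.
  + by rewrite setDE setCK setIC -setDE.
- move=> B rB e e0.
  (* The errors sum to [e / 2]; the other half of [e] pays for truncating the union of the closed
     sets. *)
  have en0 n : 0 < e / 2 / (2 ^ n.+1)%:R by rewrite !divr_gt0// ltr0n expn_gt0.
  have [C /choice[V CV]] := choice (fun n => rB n _ (en0 n)).
  have mC n : measurable (C n : set (borel X)).
    by apply: closed_measurable_borel; case: (CV n).
  have mO n : measurable (V n : set (borel X)).
    by apply: open_measurable_borel; case: (CV n).
  have mUO : measurable (\bigcup_n V n : set (borel X)).
    exact: bigcup_measurable.
  (* A countable union of closed sets need not be closed, so only the first [n] are kept. The sets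
     [D n] decrease to a set of measure at most [e / 2], hence some [D n] has measure below [e]. *)
  pose D n := (\bigcup_n V n) `\` (\big[setU/set0]_(i < n) C i).
  have mD n : measurable (D n : set (borel X)).
    by apply: measurableD => //; exact: bigsetU_measurable.
  have [||n ltn] := @nonincreasing_measure_lt _ _ _ mu D e%:E mD.
  + apply/nonincreasing_seqP => n; apply/subsetPset; apply: setDS.
    by rewrite big_ord_recr/=; exact: subsetUl.
  + apply: (@le_lt_trans _ _ (e / 2)%:E); last by rewrite lte_fin; lra.
    have sub : \bigcap_n D n `<=` \bigcup_n (V n `\` C n).
      move=> x Dx; have [[n _ Onx] _] := Dx 0 I; exists n => //; split => //.
      move=> Cx; have [_] := Dx n.+1 I; apply.
      by rewrite big_ord_recr/=; right.
    apply: le_trans (_ : (\sum_(n <oo) mu (V n `\` C n) <= _)%E).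
      apply: measure_sigma_subadditive => //.
      * by move=> n; exact: measurableD.
      * by apply: bigcap_measurable => //; exact: nat_nonempty.
    (* The zero summand gives the series the shape required by [epsilon_trick]. *)
    apply: le_trans
      (_ : (\sum_(n <oo) (0 + (e / 2 / (2 ^ n.+1)%:R)%:E) <= _)%E).
      apply: lee_nneseries => // n _.
      by rewrite add0e; case: (CV n).
    apply: le_trans (epsilon_trick xpredT _ _) _ => //; first lra.
    by rewrite eseries0// add0e.
  exists (\big[setU/set0]_(i < n) C i), (\bigcup_n V n); split.
  + by apply: closed_bigsetU => i _; case: (CV i).
  + by apply: bigcup_open => i _; case: (CV i).
  + rewrite -bigcup_mkord => x [i _ Cx]; exists i => //.
    by case: (CV i) => _ _ + _ _; apply.
  + move=> x [i _ Bx]; exists i => //.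
    by case: (CV i) => _ _ _ + _; apply.
  + exact: ltW.
Qed.

End regularity.

(** * Logarithms and entropy sums *)

Lemma gibbs_inequality (R : realType) (I : finType) (p q : I -> R) :
  (forall i, 0 <= p i) -> (forall i, 0 < q i) -> \sum_i q i <= \sum_i p i ->
  - \sum_i p i * ln (p i) <= \sum_i p i * - ln (q i).
Proof.
move=> p0 q0 le_qp; rewrite -sumrN -subr_le0 -sumrB.
apply: (@le_trans _ _ (\sum_i (q i - p i))); last by rewrite sumrB subr_le0.
apply: ler_sum => i _.
(* Termwise, [ln t <= t - 1] is applied to [t = q i / p i]; this needs [p i] nonzero, and otherwise
   the term on the left vanishes. *)
have [pi0|pi_neq0] := eqVneq (p i) 0.
  by rewrite pi0 !mul0r oppr0 !addr0 ltW.
have pi_gt0 : 0 < p i by rewrite lt_neqAle eq_sym pi_neq0 p0.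
have -> : - (p i * ln (p i)) - p i * - ln (q i) = p i * ln (q i / p i).
  by rewrite ln_div ?posrE//; lra.
have /(ler_wpM2l (ltW pi_gt0)) : ln (q i / p i) <= q i / p i - 1.
  rewrite -[X in ln X](subrKC 1); apply: le_ln1Dx.
  by rewrite -subr_gt0 opprK subrK divr_gt0.
by rewrite mulrBr mulr1 mulrCA divff// mulr1.
Qed.

Lemma ln_prod (R : realType) (I : finType) (f : I -> R) :
  (forall i, 0 < f i) -> ln (\prod_i f i) = \sum_i ln (f i).
Proof.
move=> f0.
suff [//] : ln (\prod_i f i) = \sum_i ln (f i) /\ 0 < \prod_i f i.
elim/big_rec2: _ => [|i x y _ [<- x0]]; first by rewrite ln1 ltr01.
by rewrite lnM ?posrE// mulr_gt0.
Qed.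

Lemma ln_natr_div_onem_ge0 (R : realType) (n : nat) (s : R) :
  (0 < n)%N -> 0 < s < 1 -> 0 <= ln (n%:R / (1 - s)).
Proof.
move=> n_gt0 /andP[s_gt0 s_lt1]; apply: ln_ge0.
rewrite ler_pdivlMr ?subr_gt0// mul1r (@le_trans _ _ 1) ?ler1n//; lra.
Qed.

(** A value taken at several indices is counted once on the right, and dropping nonpositive
    repetitions can only raise the sum. This passes from sums over itineraries to [shannon_entropy],
    which sums over distinct cells. *)
Lemma sum_le_fsbig_range (R : realType) (I : finType) (J : choiceType)
    (f : I -> J) (g : J -> R) :
  (forall i, g (f i) <= 0) -> \sum_i g (f i) <= \sum_(j \in range f) g j.
Proof.
move=> g_le0; have -> : range f = [set` undup (codom f)].
  apply/seteqP; split=> [_ [i _ <-]|j]/=; rewrite mem_undup.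
    exact: codom_f.
  by move=> /codomP[i ->]; exists i.
rewrite -fsbig_seq ?undup_uniq//.
have -> : \sum_i g (f i) = \sum_(j <- codom f) g j by rewrite big_image.
have : {in codom f, forall j, g j <= 0} by move=> _ /codomP[i ->].
elim: (codom f) => //= j s IHs gs_le0.
have {}IHs := IHs (fun k ks => gs_le0 k (@mem_behead _ (j :: s) k ks)).
rewrite big_cons; case: ifP => _; rewrite ?big_cons ?lerD2l//.
by rewrite ler_wnDl// gs_le0 ?mem_head.
Qed.

(** * Itineraries: elements of a join, indexed by their names *)

Definition itinerary_cell (T : Type) (G I : finType) (f : G -> T -> T)
    (U : I -> set T) (w : {ffun G -> I}) : set T :=
  [set x | forall g, U (w g) (f g x)].

Lemma itinerary_cell_cover (T : Type) (G I : finType) (f : G -> T -> T)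
    (U : I -> set T) :
  (forall x, exists i, U i x) -> forall x, exists w, itinerary_cell f U w x.
Proof.
move=> Ucover x; have [w xw] := choice (fun g => Ucover (f g x)).
by exists [ffun g => w g] => g; rewrite ffunE.
Qed.

Lemma measurable_itinerary_cell (disp : measure_display)
    (T : measurableType disp) (G I : finType) (f : G -> T -> T)
    (U : I -> set T) (w : {ffun G -> I}) :
  (forall g A, measurable A -> measurable (f g @^-1` A)) ->
  (forall i, measurable (U i)) -> measurable (itinerary_cell f U w).
Proof.
move=> mf mU.
have -> : itinerary_cell f U w = \bigcap_(g in [set: G]) f g @^-1` U (w g).
  by apply/seteqP; split=> [x wx g _|x wx g]; exact: wx.
apply: fin_bigcap_measurable => [|g _]; first exact: finite_finset.
exact: mf.
Qed.

(** * Entropy bound by coding itineraries *)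

Section coding.
Context {disp : measure_display} {T : measurableType disp} {R : realType}.
Variables (mu : probability T R) (I G V : finType) (f : G -> T -> T).
Variables (P : I -> set T) (bad : set T) (t : V -> G -> I) (s : R).
Hypothesis s01 : 0 < s < 1.
Hypothesis measurable_f :
  forall g A, measurable A -> measurable (f g @^-1` A).
Hypothesis mu_f : forall g, mu (f g @^-1` bad) = mu bad.
Hypothesis measurable_P : forall i, measurable (P i).
Hypothesis measurable_bad : measurable bad.
Hypothesis P_cover : forall x, exists i, P i x.
Hypothesis P_disjoint : forall x i j, P i x -> P j x -> i = j.
Hypothesis guess : forall x, exists v,
  forall g i, P i (f g x) -> ~ bad (f g x) -> i = t v g.

Let cell := itinerary_cell f P.
(** Code lengths: [ln #|V|] for naming a guess, [- ln s] at every time, and a surcharge [L] at each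
    time when the guess is wrong. *)
Let L := ln (#|I|%:R / (1 - s)).
Let bound := ln #|V|%:R + #|G|%:R * - ln s.

(* The law of a random itinerary: pick a guess [v] uniformly, then at each time
   follow [t v] with probability [s] and a uniform cell otherwise. *)
Let r v g i := (1 - s) / #|I|%:R + s * (i == t v g)%:R.
Let q (w : {ffun G -> I}) := #|V|%:R^-1 * \sum_v \prod_g r v g (w g).

Let I_gt0 : 0 < #|I|%:R :> R.
Proof.
by rewrite ltr0n; have [i _] := P_cover point; apply/card_gt0P; exists i.
Qed.

Let V_gt0 : 0 < #|V|%:R :> R.
Proof.
by rewrite ltr0n; have [v _] := guess point; apply/card_gt0P; exists v.
Qed.

Let r0_gt0 : 0 < (1 - s) / #|I|%:R.
Proof. by rewrite divr_gt0// subr_gt0; case/andP: s01. Qed.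

Let r_gt0 v g i : 0 < r v g i.
Proof. by rewrite ltr_wpDr// mulr_ge0//; case/andP: s01 => /ltW. Qed.

Let q_gt0 w : 0 < q w.
Proof.
rewrite mulr_gt0 ?invr_gt0//; have [v _] := guess point.
rewrite (bigD1 v)//= ltr_wpDr ?sumr_ge0// => [u _|].
  by rewrite prodr_ge0// => g _; exact: ltW.
by rewrite prodr_gt0.
Qed.

Let sum_q : \sum_w q w = 1.
Proof.
rewrite -mulr_sumr exchange_big/=.
(* The sum over itineraries of a product is the product over times of sums, each equal to
   [(1 - s) + s]. *)
under eq_bigr do rewrite -bigA_distr_bigA.
rewrite (eq_bigr (fun=> 1)) => [|v _].
  by rewrite sumr_const cardT -cardE mulVf// gt_eqF.
apply: big1 => g _; rewrite big_split/= sumr_const -mulr_sumr.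
rewrite (bigD1 (t v g))//= eqxx big1 => [|i /negbTE ->//].
rewrite addr0 mulr1 cardT -cardE -[_ *+ _]mulr_natr divfK ?gt_eqF//.
by rewrite subrK.
Qed.

Let L_ge0 : 0 <= L.
Proof. by apply: ln_natr_div_onem_ge0; rewrite // -(ltr0n R). Qed.

Let ln_s_le0 : ln s <= 0.
Proof. by apply: ln_le0; case/andP: s01 => _ /ltW. Qed.

(** A right guess has [r >= s]; a wrong one has [- ln r = L], and [- ln s] is nonnegative. *)
Let ln_r v g i : - ln (r v g i) <= - ln s + L * (i != t v g)%:R.
Proof.
rewrite /r; have [_|_] := eqVneq i; rewrite /= ?(mulr0, mulr1, addr0).
  have s_gt0 : 0 < s by case/andP: s01.
  by rewrite lerN2 ler_ln ?posrE ?addr_gt0// lerDr ltW.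
by rewrite -lnV ?posrE// invf_div lerDr oppr_ge0.
Qed.

Let ln_q x w : cell w x ->
  - ln (q w) <= bound + \sum_g L * \1_(f g @^-1` bad) x.
Proof.
move=> wx; have [v xv] := guess x.
(* Of the average defining [q w], keep only the summand of the guess [v] suited to [x]; this guess
   errs only when the orbit is in [bad]. *)
apply: (@le_trans _ _ (- ln (#|V|%:R^-1 * \prod_g r v g (w g)))).
  have prod_gt0 u : 0 < \prod_g r u g (w g) by exact: prodr_gt0.
  rewrite lerN2 ler_ln ?posrE ?q_gt0 ?mulr_gt0 ?invr_gt0//.
  rewrite /q ler_pM2l ?invr_gt0// [leRHS](bigD1 v)//= lerDl.
  by rewrite sumr_ge0// => u _; exact: ltW.
rewrite lnM ?posrE ?invr_gt0 ?prodr_gt0// lnV ?posrE// opprD opprK ln_prod//.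
rewrite /bound -addrA lerD2l -sumrN.
have -> : #|G|%:R * - ln s = \sum_(g : G) - ln s.
  by rewrite sumr_const mulr_natl.
rewrite -big_split/=.
apply: ler_sum => g _; apply: le_trans (ln_r _ _ _) _.
rewrite lerD2l ler_wpM2l// indicE ler_nat.
have [//|] := eqVneq (w g) (t v g).
case: (boolP (x \in _)) => // /negP nbad /eqP[]; apply: xv => // bad_x.
by apply: nbad; rewrite inE.
Qed.

Let measurable_cell w : measurable (cell w).
Proof. exact: measurable_itinerary_cell. Qed.

Let q_le1 w : q w <= 1.
Proof.
rewrite -sum_q (bigD1 w)//= lerDl sumr_ge0// => w' _; exact: ltW.
Qed.

(** By Gibbs, the entropy of the cells is at most the mean of [- ln (q w)]; integrating [ln_q]
    bounds this mean, each time contributing [L] times the measure of [bad] by invariance. *)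
Lemma coding_entropy_le :
  - \sum_(w : {ffun G -> I}) fine (mu (cell w)) * ln (fine (mu (cell w))) <=
  bound + #|G|%:R * (L * fine (mu bad)).
Proof.
have bound_ge0 : 0 <= bound.
  by rewrite addr_ge0 ?mulr_ge0 ?oppr_ge0// ln_ge0// ler1n -(ltr0n R).
have lnq0 w : 0 <= - ln (q w) by rewrite oppr_ge0 ln_le0.
have cell_of := itinerary_cell_cover f P_cover.
have le1 : 1 <= \sum_w fine (mu (cell w)).
  rewrite -[leLHS](congr1 fine (probability_setT mu)).
  by apply: fine_measure_le_sum => // x _; exact: cell_of.
apply: le_trans (gibbs_inequality _ q_gt0 _) _.
- by move=> w; exact: fine_ge0.
- by rewrite sum_q.
under eq_bigr do rewrite mulrC.
have -> : #|G|%:R * (L * fine (mu bad)) =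
    \sum_g L * fine (mu (f g @^-1` bad)).
  by under eq_bigr do rewrite mu_f; rewrite sumr_const mulr_natl cardT -cardE.
apply: le_sum_measure_indic => //.
  by move=> g; exact: measurable_f.
(* Exactly one cell contains [x], so a single term of the sum survives. *)
move=> x; have [w wx] := cell_of x.
rewrite (bigD1 w)//= big1 => [|w' w'w].
  by rewrite addr0 indicE mem_set// mulr1; exact: ln_q.
rewrite indicE memNset ?mulr0// => w'x; case/eqP: w'w.
by apply/ffunP => g; exact: P_disjoint (w'x g) (wx g).
Qed.

End coding.

(** * Minimal subcovers and joins of translates *)

Lemma has_min_subcover (Y : Type) (C : set (set Y)) :
  finite_set C -> cover C id = setT -> has_subcover C (min_subcover C).
Proof.
move=> finC covC.
(* [min_subcover] is defined by [get], so a minimum must be exhibited before its property can be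
   used; [C] itself is a finite subcover. *)
have exC : exists n, `[< has_subcover C n >].
  exists #|` fset_set C|; apply/asboolP; exists (fset_set C).
  by split; rewrite ?fset_setK.
have [n /asboolP Cn min_n] := ex_minnP exC.
suff [] : has_subcover C (min_subcover C) /\
    forall m, has_subcover C m -> (min_subcover C <= m)%N by [].
apply: (@getPex _ [set n | has_subcover C n /\
  forall m, has_subcover C m -> (n <= m)%N]).
by exists n; split=> // m Cm; apply: min_n; exact/asboolP.
Qed.

Section action.
Variables (Gamma : groupType) (X : topologicalType) (a : Gamma -> X -> X).
Hypothesis action_a : top_action a.

Lemma top_action1 x : a 1%g x = x.
Proof.
have [/(_ 1%g)[_ [h [_ ah _]]] aM] := action_a.
apply: (can_inj ah); have /(congr1 (@^~ x)) := aM 1%g 1%g.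
by rewrite mulg1.
Qed.

Lemma top_actionK g : cancel (a g) (a g^-1%g).
Proof.
have [_ aM] := action_a; move=> x.
by have /(congr1 (@^~ x)) := aM g^-1%g g; rewrite mulVg top_action1.
Qed.

Lemma top_actionKV g : cancel (a g^-1%g) (a g).
Proof.
have [_ aM] := action_a; move=> x.
by have /(congr1 (@^~ x)) := aM g g^-1%g; rewrite mulgV top_action1.
Qed.

Lemma image_top_action g (A : set X) : a g @` A = a g^-1%g @^-1` A.
Proof.
apply/seteqP; split=> [_ [x Ax <-]|x Ax]/=; first by rewrite top_actionK.
by exists (a g^-1%g x) => //; exact: top_actionKV.
Qed.

(** Since [a g] maps [A] onto the preimage of [A] under [a g^-1], an element of the join consists of
    the points with a prescribed itinerary under the inverses of [F]. *)
Lemma join_translates_range (I : finType) (U : I -> set X) (F : {fset Gamma}) :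
  join_translates a (range U) F =
  range (itinerary_cell (fun g : F => a (val g)^-1%g) U).
Proof.
apply/seteqP; split=> [_ [A FA <-]|_ [w _ <-]].
  have /choice[w wA] : forall g : F, exists i, a (val g) @` U i = A (val g).
    by move=> g; have [_ [i _ <-] <-] := FA _ (valP g); exists i.
  exists [ffun g => w g] => //; apply/seteqP; split=> [x wx g /= gF|x Ax g].
    have := wx [` gF]%fset; rewrite ffunE -(wA [` gF]%fset).
    by rewrite image_top_action.
  by have := Ax _ (valP g); rewrite -wA image_top_action ffunE.
(* The join wants a choice on all of [Gamma]; the value outside [F] is arbitrary. *)
exists (fun g => if insub g is Some h then a g @` U (w h) else set0).
  move=> g gF; rewrite (@insubT _ (fun g => g \in F) _ _ gF).
  by exists (U (w [` gF]%fset)).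
apply/seteqP; split=> [x Ax g|x wx g /= gF].
  have := Ax _ (valP g); rewrite valK image_top_action; exact.
rewrite (@insubT _ (fun g => g \in F) _ _ gF) image_top_action.
exact: (wx [` gF]%fset).
Qed.

End action.

(** * Comparison of partition entropy with cover entropy *)

Lemma subcover_entropy_le (R : realType) (Gamma : groupType)
    (X : ptopologicalType) (a : Gamma -> X -> X) (mu : probability (borel X) R)
    (I : finType) (P U : I -> set X) (bad : set X) (s : R) (F : {fset Gamma}) :
  top_action a -> invariant_measure a mu -> 0 < s < 1 ->
  (forall i, measurable (P i : set (borel X))) ->
  measurable (bad : set (borel X)) ->
  (forall x, exists i, P i x) -> (forall x, exists i, U i x) ->
  (forall x i j, P i x -> P j x -> i = j) ->
  (forall x i j, P i x -> U j x -> ~ bad x -> i = j) ->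
  shannon_entropy mu (join_translates a (range P) F) <=
  ln (min_subcover (join_translates a (range U) F))%:R +
  #|` F|%:R * (- ln s + ln (#|I|%:R / (1 - s)) * fine (mu bad)).
Proof.
move=> act_a inv_mu s01 mP mbad Pcov Ucov Pdisj PU.
have mf (g : F) (A : set (borel X)) :
    measurable A -> measurable (a (val g)^-1%g @^-1` A : set (borel X)).
  have [/(_ (val g)^-1%g)[cg _] _] := act_a.
  exact: continuous_measurable_borel.
rewrite !join_translates_range//.
set f := fun g : F => a (val g)^-1%g.
set C := range (itinerary_cell f U).
have [W [WC Wcov <-]] : has_subcover C (min_subcover C).
  apply: has_min_subcover; first exact/finite_image/finite_finset.
  apply/seteqP; split=> // x _; have [w wx] := itinerary_cell_cover f Ucov x.
  by exists (itinerary_cell f U w) => //; exists w.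
(* The guesses are the members of a minimal subcover, each read as the itinerary [t v] that defines
   it. *)
have /choice[t tW] : forall v : W, exists w, itinerary_cell f U w = val v.
  by move=> v; have [w _ wv] := WC _ (valP v); exists w.
have := @coding_entropy_le _ (borel X) R mu I F W f P bad (fun v => t v) s
  s01 mf _ mP mbad Pcov Pdisj.
rewrite -!cardfE mulrDr addrA => H; apply: le_trans (H _ _).
- rewrite lerN2; apply: sum_le_fsbig_range => w.
  have mw : measurable (itinerary_cell f P w : set (borel X)).
    exact: measurable_itinerary_cell.
  rewrite mulr_ge0_le0 ?fine_ge0// ln_le0// -lee_fin fineK ?fin_num_measure//.
  exact: probability_le1.
- by move=> g; exact: inv_mu.
- move=> x; have [v Wv vx] : cover [set` W] id x by rewrite Wcov.
  exists [` Wv]%fset => g i Pi nbad.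
  have : itinerary_cell f U (t [` Wv]%fset) x by rewrite tW.
  by move=> /(_ g) Ug; exact: PU Pi Ug nbad.
Qed.

Lemma partition_entropy_le (R : realType) (Gamma : groupType)
    (X : ptopologicalType) (a : Gamma -> X -> X) (mu : probability (borel X) R)
    (P : set (set (borel X))) (e : R) :
  metrizable R X -> top_action a -> invariant_measure a mu ->
  finite_measurable_partition P -> 0 < e ->
  exists2 U, finite_open_cover U & forall F : {fset Gamma},
    shannon_entropy mu (join_translates a P F) <=
    ln (min_subcover (join_translates a U F))%:R + #|` F|%:R * e.
Proof.
move=> metX act_a inv_mu [/finite_fsetP[Q ->] mP covP trivP] e0.
have -> : [set` Q] = range (val : Q -> set (borel X)).
  apply/seteqP; split=> [A AQ|_ [A _ <-]]; last exact: valP.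
  by exists [` AQ]%fset.
pose p (i : Q) : set X := val i.
have pcov x : exists i, p i x.
  have : cover [set` Q] id x by rewrite covP.
  by move=> [A AQ Ax]; exists [` AQ]%fset.
have pdisj x i j : p i x -> p j x -> i = j.
  move=> pix pjx; apply: val_inj.
  by apply: trivP; [exact: valP|exact: valP|exists x].
have mp i : measurable (p i : set (borel X)) by apply: mP; exact: valP.
have k_gt0 : 0 < #|{: Q}|%:R :> R.
  by rewrite ltr0n; have [i _] := pcov point; apply/card_gt0P; exists i.
(* Chosen so that [- ln s = e / 2]. *)
pose s : R := expR (- (e / 2)).
have s01 : 0 < s < 1 by rewrite expR_gt0/= expR_lt1 oppr_lt0 divr_gt0.
pose L : R := ln (#|{: Q}|%:R / (1 - s)).
have L_ge0 : 0 <= L by apply: ln_natr_div_onem_ge0; rewrite // -(ltr0n R).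
(* With one error [eta] per cell, [L] times the measure of [bad] is at most [e / 2]. Using [L + 1]
   keeps the denominator positive from [0 <= L] alone. *)
pose eta : R := e / 2 / (#|{: Q}|%:R * (L + 1)).
have eta_gt0 : 0 < eta by rewrite !divr_gt0// mulr_gt0// ltr_wpDl.
have /choice[B HB] : forall i, exists B : set X, [/\ closed B, B `<=` p i &
    fine (mu (p i `\` B : set (borel X))) <= eta].
  move=> i.
  have [B [V [cB oV Bp pV le_eta]]] := borel_regular mu metX (mp i) eta_gt0.
  exists B; split=> //.
  have mB := closed_measurable_borel cB; have mV := open_measurable_borel oV.
  rewrite -lee_fin fineK ?fin_num_measure//; last exact: measurableD.
  apply: le_trans le_eta; apply: le_measure; rewrite ?inE.
  - exact: measurableD.
  - exact: measurableD.
  - exact: setSD.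
have cB i : closed (B i) by case: (HB i).
have Bp i : B i `<=` p i by case: (HB i).
have mD i : measurable (p i `\` B i : set (borel X)).
  by apply: measurableD => //; exact: closed_measurable_borel.
pose bad := \bigcup_i (p i `\` B i).
have mbad : measurable (bad : set (borel X)).
  by apply: fin_bigcup_measurable => //; exact: finite_finset.
pose U i := ~` (\bigcup_(j in [set j | j != i]) B j).
have pU i : p i `<=` U i.
  by move=> x pix [j /eqP ji /Bp pjx]; apply: ji; exact: pdisj pjx pix.
have Ucov x : exists i, U i x.
  by have [i pix] := pcov x; exists i; exact: pU.
exists (range U).
  split.
  - exact/finite_image/finite_finset.
  - move=> _ [i _ <-]; apply: closed_openC; apply: closed_bigcup => //.
    exact: finite_finset.
  - apply/seteqP; split=> // x _; have [i Uix] := Ucov x.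
    by exists (U i) => //; exists i.
move=> F; apply: le_trans (subcover_entropy_le (U := U) (bad := bad) F
  act_a inv_mu s01 mp mbad pcov Ucov pdisj _) _.
  (* If [i != j], then [U j] avoids [B i]; but a point of [p i] outside [bad] lies in [B i]. *)
  move=> x i j pix Ujx nbad; apply/eqP; apply: contra_notT Ujx => ij.
  exists i => //; apply: contrapT => nBix.
  by apply: nbad; exists i.
rewrite lerD2l ler_wpM2l// expRK opprK.
have le_bad : fine (mu bad) <= #|{: Q}|%:R * eta.
  apply: le_trans (@fine_measure_le_sum _ _ _ mu _ _ _ mbad mD _) _.
    by move=> x [i _ Dx]; exists i.
  rewrite mulr_natl -sumr_const; apply: ler_sum => i _.
  by case: (HB i).
rewrite [leRHS](_ : e = e / 2 + e / 2); last lra.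
rewrite lerD2l (le_trans (ler_wpM2l L_ge0 le_bad))//.
have -> : L * (#|{: Q}|%:R * eta) = e / 2 * (L / (L + 1)).
  by rewrite /eta; field; rewrite !gt_eqF// ltr_wpDl.
apply: ler_piMr; first by rewrite divr_ge0// ltW.
by rewrite ler_pdivrMr ?mul1r ?lerDl// ltr_wpDl.
Qed.

Theorem theorem1p3 (R : realType) (Gamma : groupType)
    (countableGamma : countable [set: Gamma])
    (X : ptopologicalType) (compactX : compact [set: X])
    (metrizableX : metrizable R X)
    (a : Gamma -> X -> X) (action_a : top_action a)
    (mu : probability (borel X) R) (invariant_mu : invariant_measure a mu) :
  (naive_measure_entropy a mu <= naive_top_entropy R a)%E.
Proof.
apply: ge_ereal_sup => _ [P partP <-]; apply/lee_addgt0Pr => e e0.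
have [U covU PU] := partition_entropy_le metrizableX action_a invariant_mu
  partP e0.
apply: le_trans (_ : (naive_top_entropy_cover R a U + e%:E <= _)%E); last first.
  by rewrite leeD2r//; apply: ereal_sup_ubound; exists U.
(* The cover [U] serves every [F], so the infima are compared term by term after dividing by the
   cardinality of [F]. *)
rewrite -leeBlDr//; apply: le_ereal_inf_tmp => _ [F F0 <-].
rewrite leeBlDr//; apply: ge_ereal_inf; exists
  ((#|` F|%:R)^-1 * shannon_entropy mu (join_translates a P F))%:E.
  by exists F.
have F_gt0 : 0 < #|` F|%:R :> R by rewrite ltr0n cardfs_gt0.
rewrite -EFinD lee_fin ler_pdivrMl// mulrDr mulVKf ?gt_eqF//.
Qed.
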